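(* Let $(S_n)_{n\ge0}$ be a centered (mean-zero) martingale with $\mathbb{E}[S_n^2]=n$ for every $n$, let $T$ be a first-passage time of $(S_n)$, i.e. $T=\inf\{n\ge1:S_n>r\}$ for some level $r\ge0$, with $\mathbb{E}[|S_T|\mathbf{1}(T<\infty)]<\infty$, and let $L=\mathbb{E}[S_T\mathbf{1}(T<\infty)]$, a finite real number. Then, for every $p>1$, $$|L|^{p/(p-1)}\le\liminf_{n\to\infty}\ \mathbb{P}(T>n)\,\bigl(\mathbb{E}[|S_n|^p\mathbf{1}(T>n)]\bigr)^{1/(p-1)}.$$ The case $p=2$, after dropping the indicator inside the moment, gives $$\liminf_{n\to\infty}\ n\,\mathbb{P}(T>n)\ge L^2.$$
   Context: $T$ is extended-valued, with $\inf\varnothing=\infty$; the event $\{T=\infty\}$ may have positive probability. For $p>1$ the moment $\mathbb{E}[|S_n|^p\mathbf{1}(T>n)]$ takes values in $[0,\infty]$. *)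

(* Defs.v *)
From HB Require Import structures.
From mathcomp Require Import all_boot all_order all_algebra.
From mathcomp Require Import all_classical all_reals all_analysis.

Set Implicit Arguments.
Unset Strict Implicit.
Unset Printing Implicit Defensive.

Import Order.TTheory GRing.Theory Num.Theory.
Import numFieldNormedType.Exports.

Local Open Scope classical_set_scope.
Local Open Scope ring_scope.

Section martingales.
Context {d : measure_display} {Omega : measurableType d} {R : realType}.
Variable P : probability Omega R.

Definition filtration (F : nat -> set (set Omega)) : Prop :=
  [/\ forall n, sigma_algebra setT (F n),
      forall n, F n `<=` measurable &
      forall m n, (m <= n)%N -> F m `<=` F n].

Definition measurable_wrt (G : set (set Omega)) (X : Omega -> R) : Prop :=
  forall B : set R, measurable B -> G (X @^-1` B).

(* Y is a version of the conditional expectation E[X | G]. *)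
Definition is_condexp (G : set (set Omega)) (X Y : Omega -> R) : Prop :=
  [/\ measurable_wrt G Y,
      P.-integrable setT (EFin \o Y) &
      forall A, G A ->
        (\int[P]_(w in A) (Y w)%:E = \int[P]_(w in A) (X w)%:E)%E].

Definition martingale (F : nat -> set (set Omega)) (S : nat -> {RV P >-> R}) :
    Prop :=
  [/\ filtration F,
      forall n, measurable_wrt (F n) (S n),
      forall n, P.-integrable setT (EFin \o S n) &
      forall n, is_condexp (F n) (S n.+1) (S n)].

End martingales.

Section first_passage.
Context {Omega : Type} {R : realType}.

(* [ereal_inf set0 = +oo]. *)
Definition first_passage (S : nat -> Omega -> R) (r : R) (w : Omega) : \bar R :=
  ereal_inf [set (n%:R)%:E | n in [set n : nat | (1 <= n)%N /\ r < S n w]].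

(* S_T 1(T < oo), for T with values in {0, 1, ...} U {+oo}: there
   [Num.truncn (fine (T w))] is the value of T at w as a natural number whenever
   T w is finite, and the indicator discards the other w. *)
Definition stopped (S : nat -> Omega -> R) (T : Omega -> \bar R) (w : Omega) :
    R :=
  S (Num.truncn (fine (T w))) w * \1_[set w' | (T w' < +oo)%E] w.

End first_passage.

(* Main.v *)
Require Import Defs.
From HB Require Import structures.
From mathcomp Require Import all_boot all_order all_algebra.
From mathcomp Require Import all_classical all_reals all_analysis.
From mathcomp Require Import measurable_realfun.

(** Write A_n for the event {T > n}. Optional stopping at the bounded time
    min(T, n) gives
      E[S_T 1(T <= n)] + E[S_n 1(A_n)] = E[S_0] = 0.
    Since S_T 1(T < oo) is integrable, dominated convergence sends the first
    term to L, so the deficit |E[S_n 1(A_n)]| tends to |L|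
    ([cvg_integral_survival]): whatever mass the stopped martingale loses in
    the limit is carried by the paths that have not crossed yet.

    For fixed n, Hoelder's inequality with exponents p and q = p / (p - 1),
    applied to S_n 1(A_n) and 1(A_n), bounds this deficit to the power q by
    P(A_n) E[|S_n|^p 1(A_n)]^(1 / (p - 1)) ([hoelder_set]); the inferior limit
    of both sides is the first inequality. At p = 2 the moment is at most
    E[S_n^2] = n, which gives the second one. *)

Set Implicit Arguments.
Unset Strict Implicit.
Unset Printing Implicit Defensive.

Import Order.TTheory GRing.Theory Num.Theory.
Import numFieldNormedType.Exports.

Local Open Scope classical_set_scope.
Local Open Scope ring_scope.

(** * Inferior limits and Hoelder's inequality on a set *)

Lemma le_limn_einf (R : realType) (u v : (\bar R)^nat) :
  (forall n, (u n <= v n)%E) -> (limn_einf u <= limn_einf v)%E.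
Proof.
move=> uv; rewrite !limn_einf_lim.
apply: lee_lim; [exact: is_cvg_einfs|exact: is_cvg_einfs|apply: nearW => n].
apply: le_ereal_inf_tmp => _ [m /= nm <-]; apply: le_trans (uv m).
by apply: ereal_inf_lbound; exists m.
Qed.

Lemma limn_einf_ge0 (R : realType) (u : (\bar R)^nat) :
  (forall n, (0 <= u n)%E) -> (0 <= limn_einf u)%E.
Proof.
move=> u0.
have [<- _] := cvg_limn_einf_sup (@cvg_cst _ (0%E : \bar R) nat \oo _).
exact: le_limn_einf.
Qed.

(** Passing to the limit in a bound on powers. At l > 0 the power function is
    differentiable, hence continuous; at l = 0, where it is not differentiable
    for q < 1, the conclusion only says that the inferior limit is
    nonnegative. *)
Lemma poweR_le_limn_einf (R : realType) (q : R) (u v : (\bar R)^nat)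
    (l : \bar R) :
  0 < q -> (0 <= l)%E -> l \is a fin_num -> u @ \oo --> l ->
  (forall n, (u n `^ q <= v n)%E) -> (l `^ q <= limn_einf v)%E.
Proof.
move=> q0 + lfin ul uv; rewrite le_eqVlt => /predU1P[<-|l0].
  rewrite poweR0r ?gt_eqF//; apply: limn_einf_ge0 => n.
  exact: le_trans (poweR_ge0 _ _) (uv n).
have cvuq : (u n `^ q)%E @[n --> \oo] --> (l `^ q)%E.
  case: l lfin l0 ul => // l _; rewrite lte_fin => l0 /fine_cvgP[ufin ul].
  rewrite poweR_EFin; apply/fine_cvgP; split.
    by apply: filterS ufin => n; exact: fin_num_poweR.
  under eq_cvg do rewrite /= fine_poweR.
  have : {for l, continuous ((@powR R) ^~ q)}; last first.
    by move=> cq; exact: (continuous_cvg _ cq ul).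
  apply/differentiable_continuous/derivable1_diffP.
  by apply: derivable_powR; rewrite in_itv/= l0.
have [<- _] := cvg_limn_einf_sup cvuq.
exact: le_limn_einf.
Qed.

(** Hoelder's inequality for the pair (f 1_A, 1_A), raised to the conjugate
    exponent p / (p - 1) so that the norm of 1_A becomes the plain measure of
    A. The moment may be infinite; A then has positive measure, so the
    convention 0 * oo = 0 does not make the right-hand side vanish. *)
Lemma hoelder_set (d : measure_display) (Omega : measurableType d)
    (R : realType) (mu : {measure set Omega -> \bar R}) (f : Omega -> R)
    (A : set Omega) (p : R) :
  measurable_fun setT f -> measurable A -> 1 < p ->
  (`|\int[mu]_(x in A) (f x)%:E| `^ (p / (p - 1)) <=
   mu A * (\int[mu]_x (`|f x| `^ p * \1_A x)%:E) `^ (p - 1)^-1)%E.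
Proof.
move=> mf mA p1; pose q := p / (p - 1).
have p0 : 0 < p by exact: lt_trans ltr01 p1.
have pB1 : 0 < p - 1 by rewrite subr_gt0.
have q0 : 0 < q by rewrite divr_gt0.
have pq1 : p^-1 + q^-1 = 1.
  by rewrite /q invf_div -{1}[p^-1]mul1r -mulrDl addrC subrK divff ?gt_eqF.
have m1A : measurable_fun setT (\1_A : Omega -> R) by exact: measurable_indic.
have mf1A : measurable_fun setT (f \* \1_A) by exact: measurable_funM.
have le1 : (`|\int[mu]_(x in A) (f x)%:E| <=
    'N[mu]_p%:E[EFin \o (f \* \1_A)%R] * 'N[mu]_q%:E[EFin \o \1_A])%E.
  apply: le_trans (hoelder mu mf1A m1A p0 q0 pq1).
  rewrite Lnorm1 integral_mkcond.
  apply: (le_trans (le_abse_integral _ _ _)) => //.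
    apply/(measurable_restrictT _ mA)/measurable_EFinP.
    exact: measurable_funTS.
  under eq_integral.
    move=> x _.
    rewrite (_ : `|_|%E = `|(EFin \o (f \* \1_A \* \1_A)%R) x|%E); last first.
      by rewrite patchE /= indicE; case: (x \in A); rewrite /= ?mulr1 ?mulr0.
    over.
  by [].
apply: (@le_trans _ _ (('N[mu]_p%:E[EFin \o (f \* \1_A)%R] *
    'N[mu]_q%:E[EFin \o \1_A]) `^ q)%E).
  apply: gt0_ler_poweR le1; rewrite ?ltW// in_itv/= leey andbT//.
  by rewrite mule_ge0// Lnorm_ge0.
rewrite poweRM ?Lnorm_ge0// muleC.
have -> : ('N[mu]_q%:E[EFin \o \1_A] `^ q)%E = mu A.
  rewrite poweR_Lnorm ?gt_eqF// -[RHS]/(mu A) -[A in RHS]setIT.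
  rewrite -integral_indic//.
  apply: eq_integral => x _ /=; rewrite indicE.
  by case: (x \in A); rewrite /= ?normr1 ?powR1// normr0 powR0// gt_eqF.
have -> : q = p * (p - 1)^-1 by [].
rewrite poweRrM poweR_Lnorm ?gt_eqF//.
rewrite (@eq_integral _ _ _ mu setT (fun x => (`|f x| `^ p * \1_A x)%:E))//.
move=> x _ /=.
rewrite indicE; case: (x \in A); rewrite /= ?mulr1 ?mulr0//.
by rewrite normr0 powR0// gt_eqF.
Qed.

(** * The events {T > n} *)

Section survival.
Context {Omega : Type} {R : realType}.
Variables (S : nat -> Omega -> R) (r : R).

(** The event {T > n}, phrased by finitely many constraints on S_1, ..., S_n
    instead of an infimum, so that it visibly belongs to the n-th
    sigma-algebra ([survivalE] is the identification). *)
Definition survival (n : nat) : set Omega :=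
  [set w | forall k, (0 < k <= n)%N -> S k w <= r].

Lemma survival0 : survival 0 = setT.
Proof. by apply/seteqP; split => // w _ [|k]. Qed.

Lemma survivalS n :
  survival n.+1 = survival n `&` S n.+1 @^-1` [set` `]-oo, r]].
Proof.
apply/seteqP; split => w /=.
  move=> sw; split; last by rewrite in_itv/= sw// leqnn.
  by move=> k /andP[k0 kn]; apply: sw; rewrite k0 leqW.
move=> [sw]; rewrite in_itv/= => Sr k /andP[k0]; rewrite leq_eqVlt ltnS.
by move=> /predU1P[->//|kn]; apply: sw; rewrite k0.
Qed.

Lemma survival_decr m n : (m <= n)%N -> survival n `<=` survival m.
Proof.
move=> mn w sw k /andP[k0 km]; apply: sw.
by rewrite k0 (leq_trans km).
Qed.

Lemma survival_le_first_passage n w :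
  survival n w -> (n.+1%:R%:E <= first_passage S r w)%E.
Proof.
move=> sw; apply: le_ereal_inf_tmp => _ [k [k0 rk] <-].
rewrite lee_fin ler_nat ltnNge; apply/negP => kn.
by move: rk; rewrite ltNge sw// k0.
Qed.

Lemma survivalE n : [set w | (n%:R%:E < first_passage S r w)%E] = survival n.
Proof.
apply/seteqP; split => w /=; last first.
  move=> /survival_le_first_passage; apply: lt_le_trans.
  by rewrite lte_fin ltr_nat.
move=> nT k /andP[k0 kn]; rewrite leNgt; apply/negP => rk; move: nT.
rewrite ltNge; apply/negP; rewrite negbK.
apply: (@le_trans _ _ k%:R%:E); last by rewrite lee_fin ler_nat.
by apply: ereal_inf_lbound; exists k.
Qed.

Lemma first_passage_exit n w : survival n w -> ~ survival n.+1 w ->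
  first_passage S r w = n.+1%:R%:E.
Proof.
move=> sw nsw; apply/eqP; rewrite eq_le survival_le_first_passage// andbT.
move: nsw; rewrite -survivalE /=.
by move/negP; rewrite -leNgt.
Qed.

Lemma stopped_exit n w : survival n w -> ~ survival n.+1 w ->
  stopped S (first_passage S r) w = S n.+1 w.
Proof.
move=> sw nsw; have Tw := first_passage_exit sw nsw.
by rewrite /stopped indicE mem_set /= Tw ?ltry// natrK mulr1.
Qed.

Lemma stopped_never w : (forall n, survival n w) ->
  stopped S (first_passage S r) w = 0.
Proof.
move=> sw; rewrite /stopped indicE memNset ?mulr0//=.
rewrite /first_passage [X in ereal_inf X](_ : _ = set0) ?ereal_inf0//.
apply/seteqP; split => // y [n [n0 rn] _].
by move: rn; rewrite ltNge (sw n)// n0 leqnn.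
Qed.

Lemma exitP w :
  (exists n, survival n w /\ ~ survival n.+1 w) \/ (forall n, survival n w).
Proof.
have [sw|/existsNP[n nsw]] := pselect (forall n, survival n w); [by right|left].
elim: n nsw => [|n ih nsw]; first by case; rewrite survival0.
by have [sw|/ih//] := pselect (survival n w); exists n.
Qed.

End survival.

(** * Optional stopping *)

Section optional_stopping.
Context {d : measure_display} {Omega : measurableType d} {R : realType}.
Variables (P : probability Omega R) (F : nat -> set (set Omega)).
Variables (S : nat -> {RV P >-> R}) (r : R).
Hypothesis hS : martingale F S.

Local Notation A := (survival S r).
Local Notation ST := (stopped S (first_passage S r)).

Lemma survival_adapted n : F n (A n).
Proof.
have [[sF _ incrF] adS _ _] := hS; have [F0 FC FU] := sF n.
have -> : A n = setT `\`
    \bigcup_k (if (0 < k <= n)%N then S k @^-1` [set` `]r, +oo[] else set0).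
  apply/seteqP; split => w /=.
    move=> sw; split => // -[k _]; case: ifPn => //= kn.
    by rewrite in_itv/= andbT ltNge sw.
  move=> [_ nw] k kn; rewrite leNgt; apply/negP => rk; apply: nw.
  by exists k => //; rewrite kn /= in_itv/= rk.
apply/FC/FU => k; case: ifPn => // /andP[_ kn].
by apply: incrF kn _ _; exact: adS.
Qed.

Lemma measurable_survival n : measurable (A n).
Proof. by have [[_ Fm _] _ _ _] := hS; apply: Fm; exact: survival_adapted. Qed.

(** S_T 1(T < oo) is S_(n+1) on each of the countably many events {T = n+1}
    and 0 on {T = oo}; these events partition the space. *)
Lemma measurable_stopped : measurable_fun setT ST.
Proof.
have mA := measurable_survival.
(* Index 0 stands for {T = oo} and index n+1 for {T = n+1}. *)
have -> : [set: Omega] =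
    \bigcup_n (if n is m.+1 then A m `\` A m.+1 else \bigcap_k A k).
  apply/seteqP; split => // w _; have [[n [An nAn]]|An] := exitP S r w.
    by exists n.+1.
  by exists 0%N.
apply/measurable_fun_bigcup => [[|n]|[|n]].
- exact: bigcap_measurable.
- exact: measurableD.
- apply: (eq_measurable_fun (cst 0 : Omega -> R)) => [w|//].
  by rewrite inE => An; rewrite stopped_never// => n; exact: An.
- apply: (eq_measurable_fun (S n.+1 : Omega -> R)) => [w|].
    by rewrite inE => -[An nAn]; rewrite (stopped_exit An).
  exact: measurable_funTS.
Qed.

(** The left-hand side is E[S_min(T, n)] split over {T <= n} and {T > n}. From
    n to n+1 the first integral gains the integral of S_(n+1) over {T = n+1}
    and the second one loses it, because {T > n} is known at time n and so S_n
    and S_(n+1) have the same integral over it. *)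
Lemma optional_stopping n :
  (\int[P]_(w in ~` A n) (ST w)%:E + \int[P]_(w in A n) (S n w)%:E =
   'E_P[S 0])%E.
Proof.
have mA := measurable_survival; have mST := measurable_stopped.
elim: n => [|n <-].
  by rewrite survival0 setCT integral_set0 add0e expectation_def.
have splitC : ~` A n.+1 = ~` A n `|` (A n `\` A n.+1).
  apply/seteqP; split => w /=.
    by move=> nAw; have [Aw|nAw'] := pselect (A n w); [right|left].
  by move=> [nAw Aw|[_ //]]; apply: nAw; exact: survival_decr Aw.
have splitA : A n = A n.+1 `|` (A n `\` A n.+1).
  by rewrite -[LHS](setUIDK _ (A n.+1)) (setIidr (survival_decr (leqnSn n))).
have mD : measurable (A n `\` A n.+1) by exact: measurableD.
have disjC : [disjoint ~` A n & A n `\` A n.+1].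
  by apply/disj_setPS => w [nAw [/nAw]].
have disjA : [disjoint A n.+1 & A n `\` A n.+1].
  by apply/disj_setPS => w [Aw [_ /(_ Aw)]].
rewrite splitC integral_setU//; last 2 first.
- exact: measurableC.
- exact/measurable_EFinP/measurable_funTS.
have -> : (\int[P]_(w in A n `\` A n.+1) (ST w)%:E =
    \int[P]_(w in A n `\` A n.+1) (S n.+1 w)%:E)%E.
  apply: eq_integral => w; rewrite inE => -[Aw nAw].
  by rewrite (stopped_exit Aw).
rewrite -addeA; congr (_ + _)%E.
have [_ _ _ /(_ n)[_ _ condS]] := hS.
rewrite (condS _ (survival_adapted n)) [in RHS]splitA.
rewrite integral_setU//; last first.
  exact/measurable_EFinP/measurable_funTS.
by rewrite addeC.
Qed.

(** The truncations S_T 1(T <= n) are dominated by |S_T| 1(T < oo) and at each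
    point eventually equal to S_T 1(T < oo), so optional stopping passes to
    the limit. *)
Lemma cvg_integral_survival : P.-integrable setT (EFin \o ST) ->
  (\int[P]_(w in A n) (S n w)%:E)%E @[n --> \oo] -->
  ('E_P[S 0] - 'E_P[ST])%E.
Proof.
move=> iST.
have mAC n : measurable (~` A n).
  by apply: measurableC; exact: measurable_survival.
have cvgC : (\int[P]_(w in ~` A n) (ST w)%:E)%E @[n --> \oo] -->
    (\int[P]_w (ST w)%:E)%E.
  under eq_fun do rewrite integral_mkcond.
  apply: (@dominated_cvg _ _ _ P setT measurableT _ _ (abse \o (EFin \o ST))).
  - move=> n; apply/(measurable_restrictT _ (mAC n)).
    exact/measurable_EFinP/measurable_funTS/measurable_stopped.
  - move=> w _; apply: cvg_near_cst; have [[n [_ nAw]]|Aw] := exitP S r w.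
      exists n.+1 => // m /= nm; rewrite patchE mem_set//= => Aw.
      exact/nAw/(survival_decr nm).
    by apply: nearW => n; rewrite patchE stopped_never// if_same.
  - by move=> w _.
  - exact: integrable_abse.
  - by move=> n w _; rewrite patchE; case: ifPn => // _; rewrite abse0 abse_ge0.
have fST n : (\int[P]_(w in ~` A n) (ST w)%:E)%E \is a fin_num.
  apply: integrable_fin_num; first exact: mAC.
  exact: integrableS iST.
have -> : (fun n => \int[P]_(w in A n) (S n w)%:E)%E =
    (fun n => 'E_P[S 0] - \int[P]_(w in ~` A n) (ST w)%:E)%E.
  by apply/funext => n; rewrite -(optional_stopping n) addeAC subee// add0e.
have iS : P.-integrable setT (EFin \o S 0) by have [_ _] := hS.
apply: cvgeB; [|exact: cvg_cst|by rewrite unlock].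
by rewrite fin_num_adde_defr// expectation_def integrable_fin_num.
Qed.

End optional_stopping.

(** * Lower bounds on the survival probability *)

Theorem corollary12p1
  (d : measure_display) (Omega : measurableType d) (R : realType)
  (P : probability Omega R)
  (F : nat -> set (set Omega)) (S : nat -> {RV P >-> R})
  (hS : martingale F S)
  (hcentered : forall n, ('E_P[S n] = 0)%E)
  (hvar : forall n, ('E_P[fun w => (S n w ^+ 2)%R] = n%:R%:E)%E)
  (r : R) (hr : 0 <= r)
  (T : Omega -> \bar R) (hT : T = first_passage S r)
  (hint : ('E_P[fun w => `|stopped S T w|%R] < +oo)%E)
  (L : \bar R) (hL : (L = 'E_P[stopped S T])%E) :
  [/\ L \is a fin_num,
      forall p : R, 1 < p ->
        (`|L| `^ (p / (p - 1)) <=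
         limn_einf (fun n : nat =>
           P [set w | n%:R%:E < T w] *
           'E_P[fun w => (`|S n w| `^ p * \1_[set w' | (n%:R%:E < T w')%E] w)%R]
             `^ (p - 1)^-1))%E &
      (L ^+ 2 <=
       limn_einf (fun n : nat => n%:R%:E * P [set w | n%:R%:E < T w]))%E].
Proof.
have mST := measurable_stopped r hS.
have mA n : measurable (survival S r n) by exact: measurable_survival hS n.
have iST : P.-integrable setT (EFin \o stopped S T).
  apply/integrableP; split; first by rewrite hT; exact/measurable_EFinP.
  by move: hint; rewrite unlock.
have finL : L \is a fin_num by rewrite hL unlock integrable_fin_num.
have cvg_abs : (`|\int[P]_(w in survival S r n) (S n w)%:E|%E @[n --> \oo]
    --> `|L|%E).
  have := iST; rewrite hT => /(cvg_integral_survival hS)/cvg_abse.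
  by rewrite -hT hcentered add0e -hL abseN.
have survival_moment (p : R) n :
    ('E_P[fun w => (`|S n w| `^ p * \1_[set w' | (n%:R%:E < T w')%E] w)%R] =
    \int[P]_w (`|S n w| `^ p * \1_(survival S r n) w)%:E)%E.
  by rewrite unlock hT survivalE.
have moment_bound (p : R) : 1 < p ->
    (`|L| `^ (p / (p - 1)) <=
     limn_einf (fun n => P [set w | n%:R%:E < T w] *
       'E_P[fun w => (`|S n w| `^ p * \1_[set w' | (n%:R%:E < T w')%E] w)%R]
         `^ (p - 1)^-1))%E.
  move=> p1; apply: poweR_le_limn_einf cvg_abs _ => //.
  - by rewrite divr_gt0 ?subr_gt0// (lt_trans ltr01).
  - by rewrite abse_fin_num.
  by move=> n; rewrite survival_moment hT survivalE; exact: hoelder_set.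
split => //.
have B21 : 2 - 1 = 1 :> R by rewrite (natrD _ 1 1) addrK.
have -> : (L ^+ 2 = `|L| `^ (2 / (2 - 1)))%E.
  rewrite B21 divr1 -(fineK finL) abse_EFin poweR_EFin powR_mulrn//.
  by rewrite real_normK ?num_real.
apply: le_trans (moment_bound _ _) _; first by rewrite ltr1n.
apply: le_limn_einf => n.
rewrite survival_moment B21 invr1 hT survivalE muleC.
under eq_integral do rewrite powR_mulrn// real_normK ?num_real//.
have sq0 w : (0 <= (S n w ^+ 2 * \1_(survival S r n) w)%:E)%E.
  by rewrite lee_fin mulr_ge0// sqr_ge0.
rewrite poweRe1 ?integral_ge0// lee_pmul ?integral_ge0// -(hvar n) unlock.
apply: ge0_le_integral => //.
- apply/measurable_EFinP/measurable_funM; first exact: measurable_funX.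
  exact: measurable_indic.
- by apply/measurable_EFinP; exact: measurable_funX.
by move=> w _; rewrite lee_fin ler_piMr ?sqr_ge0// indicE.
Qed.
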